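(* Let $n\geq 5$ and $x,y,z,a>0$, and suppose $y\leq\min\{a,x,z\}$. If none of the following holds: (i) $y<a<z<x$ and $a<1$; (ii) $y<x<z<a$ and $1<z$; (iii) $y\leq z<1<\min\{a,x\}$, then the Perron eigenvector of $Z_n(x,y,z,a)$ is efficient for $Z_n(x,y,z,a)$.
   Context: $Z_n(x,y,z,a)$ is the $n\times n$ matrix all of whose entries equal $1$ except: entry $(1,n-1)=y$, $(1,n)=x$, $(2,n-1)=a$, $(2,n)=z$, and $(n-1,1)=1/y$, $(n,1)=1/x$, $(n-1,2)=1/a$, $(n,2)=1/z$. It is a reciprocal matrix. The Perron eigenvector is the positive eigenvector associated with the largest eigenvalue, normalized to have first component $1$. A positive vector $w$ is efficient for a reciprocal matrix $A=[a_{ij}]$ if there is no other positive vector $w'$ with $|a_{ij}-w'_i/w'_j|\leq|a_{ij}-w_i/w_j|$ for all $i,j$ with strict inequality for at least one pair $(i,j)$. *)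

(* Defs.v *)
From mathcomp Require Import all_boot all_order all_algebra.
From mathcomp Require Import reals.

Set Implicit Arguments.
Unset Strict Implicit.
Unset Printing Implicit Defensive.

Import Order.TTheory GRing.Theory Num.Theory.

Local Open Scope ring_scope.

(* Indices are 0-based: the informal rows/columns 1, 2, n-1, n are
   0, 1, n.-2, n.-1; for 4 <= n these are four distinct indices. *)
Definition Zmx (R : realType) (n : nat) (x y z a : R) : 'M[R]_n :=
  \matrix_(i < n, j < n)
    if (i == 0 :> nat) && (j == n.-2 :> nat) then y
    else if (i == 0 :> nat) && (j == n.-1 :> nat) then x
    else if (i == 1 :> nat) && (j == n.-2 :> nat) then a
    else if (i == 1 :> nat) && (j == n.-1 :> nat) then z
    else if (i == n.-2 :> nat) && (j == 0 :> nat) then y^-1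
    else if (i == n.-1 :> nat) && (j == 0 :> nat) then x^-1
    else if (i == n.-2 :> nat) && (j == 1 :> nat) then a^-1
    else if (i == n.-1 :> nat) && (j == 1 :> nat) then z^-1
    else 1.

Definition positive_vec (R : realType) (n : nat) (w : 'cV[R]_n) : Prop :=
  forall i, 0 < w i 0.

(* [eigenvalue] is the library's, defined through row vectors; a square matrix
   and its transpose have the same eigenvalues, so it also fits the column
   eigenvectors used below. *)
Definition largest_eigenvalue (R : realType) (n : nat) (A : 'M[R]_n)
    (lambda : R) : Prop :=
  eigenvalue A lambda /\ forall mu : R, eigenvalue A mu -> mu <= lambda.

Definition perron_eigenvector (R : realType) (n : nat) (A : 'M[R]_n)
    (w : 'cV[R]_n) : Prop :=
  [/\ positive_vec w,
      exists2 lambda : R, largest_eigenvalue A lambda & A *m w = lambda *: w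
    & forall i : 'I_n, i = 0 :> nat -> w i 0 = 1].

Definition efficient (R : realType) (n : nat) (A : 'M[R]_n)
    (w : 'cV[R]_n) : Prop :=
  positive_vec w /\
  ~ exists w' : 'cV[R]_n,
      [/\ positive_vec w',
          forall i j, `|A i j - w' i 0 / w' j 0| <= `|A i j - w i 0 / w j 0|
        & exists i, exists j,
            `|A i j - w' i 0 / w' j 0| < `|A i j - w i 0 / w j 0|].

(* Main.v *)
(** If [w'] dominates [w], the set [V] of indices maximizing [w'_i / w_i] is a
    cut: [a_uv w_v < w_u] whenever [u] is outside [V] and [v] inside.  So it is
    enough that the Perron eigenvector has no proper cut.  Multiplying by the
    eigenvalue turns [a_uv w_v < w_u] into
    [0 < sum_k (a_uk - a_uv a_vk) w_k], so some coefficient is positive: this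
    is a comparison between [x], [y], [z], [a] and 1.  Moreover no [u]
    satisfies [a_ue w_e <= w_u] for all [e], with one strict inequality,
    because the eigenvalue is at least [n].  Indices 3, ..., n-2 have equal rows
    and weights, which reduces [Zmx n] to [Zmx 5].  There, the absence of such
    [u] excludes the cuts whose complement has at most two elements, and for
    the remaining ones the comparisons are contradictory or yield (i), (ii) or
    (iii). *)
Require Import Defs.
From mathcomp Require Import all_boot all_order all_algebra.
From mathcomp Require Import reals.
From mathcomp Require Import ring lra zify.

Import Order.TTheory GRing.Theory Num.Theory.

Local Open Scope ring_scope.

Set Implicit Arguments.
Unset Strict Implicit.

(** * Cuts and efficiency *)

Definition cut (R : realType) (n : nat) (A : 'M[R]_n) (w : 'cV[R]_n)
    (V : pred 'I_n) : Prop :=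
  forall u v, ~~ V u -> V v -> A u v * w v 0 < w u 0.

Lemma efficient_no_cut (R : realType) (n : nat) (A : 'M[R]_n) (w : 'cV[R]_n) :
  positive_vec w ->
  (forall V, cut A w V -> forall v, V v -> forall u, V u) ->
  efficient A w.
Proof.
move=> w0 nocut; split=> // -[w' [w'0 dom [i0 [j0 strict]]]].
pose rho i := w' i 0 / w i 0.
have ratio i : w' i 0 = rho i * w i 0 by rewrite divfK ?gt_eqF ?w0.
have rho0 i : 0 < rho i by rewrite divr_gt0.
case: (arg_maxP rho (erefl : predT i0)) => m _ mP.
have all_m i : rho i = rho m.
  apply/eqP/(nocut (fun i => rho i == rho m) _ m) => [u v|//].
  rewrite /= => + /eqP Ev.
  (* Otherwise [w u / w v <= A u v], and dominance at [(u, v)] forces [w u / w v <= w' u / w' v],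
     that is [rho v <= rho u], where [rho v] is the maximum. *)
  apply: contraNT; rewrite -leNgt -ler_pdivrMr // => Auv.
  rewrite eq_le [_ <= rho m]mP //= -Ev.
  rewrite -(ler_pM2r (w0 u)) -ratio -(ler_pM2r (divr_gt0 ltr01 (w'0 v))).
  have := dom u v; rewrite [X in _ <= X]ger0_norm ?subr_ge0 //.
  move=> /(le_trans (ler_norm _)); rewrite lerD2l lerN2 => le_w.
  have -> : rho v * w u 0 * (1 / w' v 0) = w u 0 / w v 0.
    by rewrite ratio; field; rewrite !gt_eqF.
  by rewrite mul1r.
move: strict; suff -> : w' i0 0 / w' j0 0 = w i0 0 / w j0 0 by rewrite ltxx.
by rewrite !ratio !all_m -mulf_div divff ?mul1r ?gt_eqF.
Qed.

Lemma eigenvector_row (R : realType) (n : nat) (A : 'M[R]_n) (w : 'cV[R]_n)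
    (lambda : R) (i : 'I_n) :
  A *m w = lambda *: w -> \sum_j A i j * w j 0 = lambda * w i 0.
Proof. by move=> /matrixP/(_ i 0); rewrite !mxE. Qed.

Lemma cut_gain (R : realType) (n : nat) (A : 'M[R]_n) (w : 'cV[R]_n)
    (lambda : R) (u v : 'I_n) :
  positive_vec w -> 0 < lambda -> A *m w = lambda *: w ->
  A u v * w v 0 < w u 0 -> exists k, A u v * A v k < A u k.
Proof.
move=> w0 l0 Aw lt_uv.
have row i := eigenvector_row i Aw.
apply/existsP; apply: contraLR lt_uv.
rewrite negb_exists -leNgt => /forallP le_uv.
rewrite -(ler_pM2l l0) mulrCA -!row mulr_sumr ler_sum // => k _.
by rewrite mulrA ler_wpM2r ?(ltW (w0 _)) // leNgt le_uv.
Qed.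

(** * Reciprocal matrices *)

Definition reciprocal (R : realType) (n : nat) (A : 'M[R]_n) : Prop :=
  forall i j, 0 < A i j /\ A i j * A j i = 1.

Lemma reciprocal_diag (R : realType) (n : nat) (A : 'M[R]_n) (i : 'I_n) :
  reciprocal A -> A i i = 1.
Proof.
move=> /(_ i i)[A0 /eqP]; rewrite -expr2 sqrf_eq1 => /orP[/eqP //|/eqP E].
by move: A0; rewrite E ltrNr oppr0 ltr10.
Qed.

(* Summing the entries [A i j * w j / w i] gives [n * lambda], while entries
   in positions (i, j) and (j, i) have product 1, hence sum at least 2. *)
Lemma reciprocal_eigenvalue_ge (R : realType) (n : nat) (A : 'M[R]_n)
    (w : 'cV[R]_n) (lambda : R) :
  (0 < n)%N -> reciprocal A -> positive_vec w -> A *m w = lambda *: w ->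
  n%:R <= lambda.
Proof.
move=> n0 rA w0 Aw.
pose T i j := A i j * w j 0 / w i 0.
have rowT i : \sum_j T i j = lambda.
  by rewrite -mulr_suml (eigenvector_row i Aw) mulfK ?gt_eqF ?w0.
have T2 i j : 2 <= T i j + T j i.
  have [Aij AA] := rA i j; have [Aji _] := rA j i.
  have TT : T i j * T j i = 1.
    rewrite /T mulf_div mulrACA AA mul1r [w j 0 * _]mulrC divff //.
    by rewrite mulf_neq0 ?gt_eqF ?w0.
  have Ti : 0 < T i j by rewrite !(mulr_gt0, invr_gt0).
  have Tj : 0 < T j i by rewrite !(mulr_gt0, invr_gt0).
  have -> : T i j + T j i = 2 + (T i j - 1) ^+ 2 * T j i by ring: TT.
  by rewrite lerDl mulr_ge0 ?sqr_ge0 ?ltW.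
have sumT : \sum_i \sum_j T i j = lambda *+ n.
  by under eq_bigr do rewrite rowT; rewrite sumr_const card_ord.
have sumTT : \sum_i \sum_j (T i j + T j i) = lambda *+ n *+ 2.
  under eq_bigr do rewrite big_split.
  by rewrite big_split /= [X in _ + X]exchange_big /= sumT mulr2n.
have : \sum_(i < n) \sum_(j < n) (2 : R) <= \sum_i \sum_j (T i j + T j i).
  by apply: ler_sum => i _; apply: ler_sum.
under eq_bigr do rewrite sumr_const card_ord.
rewrite sumr_const card_ord sumTT.
have -> : 2 *+ n *+ n = n%:R *+ n *+ 2 :> R.
  by rewrite -!mulrnA; congr (_ *+ _); lia.
by rewrite !ler_pMn2r.
Qed.

(** Without such an [e], every term [A u j * w j] is at most [w u], strictly for [j = v]; then
    [lambda * w u < n * w u], against [n <= lambda]. *)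
Lemma reciprocal_no_source (R : realType) (n : nat) (A : 'M[R]_n)
    (w : 'cV[R]_n) (lambda : R) (u v : 'I_n) :
  reciprocal A -> positive_vec w -> A *m w = lambda *: w ->
  A u v * w v 0 < w u 0 -> exists e, w u 0 < A u e * w e 0.
Proof.
move=> rA w0 Aw lt_uv.
have n0 : (0 < n)%N by apply: leq_ltn_trans (ltn_ord u).
have ln := reciprocal_eigenvalue_ge n0 rA w0 Aw.
apply/existsP; apply: contraLR ln; rewrite negb_exists -ltNge => /forallP le_u.
rewrite -(ltr_pM2r (w0 u)) -(eigenvector_row u Aw).
rewrite [X in _ < X](_ : _ = \sum_(j < n) w u 0).
  rewrite (bigD1 v) //= [X in _ < X](bigD1 v) //= ltr_leD // ler_sum // => j _.
  by rewrite leNgt le_u.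
by rewrite sumr_const card_ord mulr_natl.
Qed.

(** For [s] outside [V], the [e] that the second hypothesis supplies is outside [V] by the cut, and
    differs from [s] because the diagonal is 1. In a complement [{u, u'}], this gives
    [w u < A u u' * w u'] and the reverse with [A u' u], against reciprocity. The case [u = u']
    covers singletons. *)
Lemma cut_complement_gt2 (R : realType) (n : nat) (A : 'M[R]_n) (w : 'cV[R]_n)
    (V : pred 'I_n) (v u u' : 'I_n) :
  reciprocal A ->
  (forall i j, A i j * w j 0 < w i 0 -> exists e, w i 0 < A i e * w e 0) ->
  cut A w V -> V v -> ~~ V u -> ~~ V u' ->
  exists e, [/\ ~~ V e, e != u & e != u'].
Proof.
move=> rA nosrc cutV Vv Vu Vu'.
case: (pickP [pred e | [&& ~~ V e, e != u & e != u']]) => [e /and3P[]|none].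
  by exists e.
have heavier s t : ~~ V s -> (forall e, ~~ V e -> e = s \/ e = t) ->
    w s 0 < A s t * w t 0.
  move=> Vs st; have [e lt_e] := nosrc _ _ (cutV _ _ Vs Vv).
  have [Ve|Ve] := boolP (V e).
    by have := lt_trans lt_e (cutV _ _ Vs Ve); rewrite ltxx.
  have [Es|<- //] := st e Ve.
  by move: lt_e; rewrite Es (reciprocal_diag s rA) mul1r ltxx.
have two e : ~~ V e -> e = u \/ e = u'.
  move=> Ve; have := none e; rewrite /= Ve /= => /negbT.
  by rewrite negb_and !negbK => /orP[]/eqP; [left|right].
have lt1 := heavier u u' Vu two.
have lt2 : w u' 0 < A u' u * w u 0.
  by apply: heavier => // e /two[]; [right|left].
have [Au AA] := rA u u'.
move: lt2; rewrite -(ltr_pM2l Au) mulrA AA mul1r => /(lt_trans lt1).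
by rewrite ltxx.
Qed.

(** * Cuts in size 5 *)

(* The sign conditions for the strict inequality [a_uv w_v < w_u] in [Zmx 5],
   simplified using [y <= a], [y <= x] and [y <= z]; pairs left to [true] are
   not needed below. *)
Definition gain_cond (R : realType) (x y z a : R) (u v : nat) : bool :=
  match u, v with
  | 0%N, 1%N => z < x
  | 0%N, 2%N => 1 < x
  | 0%N, 4%N => (x < z) || (x < 1)
  | 1%N, 2%N => (1 < a) || (1 < z)
  | 1%N, 3%N => (a < 1) || (a < z)
  | 1%N, 4%N => [|| z < x, z < 1 | z < a]
  | 2%N, 0%N => y < 1
  | 2%N, 1%N => (a < 1) || (z < 1)
  | 2%N, 3%N => 1 < a
  | 2%N, 4%N => (1 < x) || (1 < z)
  | 3%N, 0%N => 1 < y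
  | 3%N, 1%N => (y < a) || (1 < a)
  | 3%N, 2%N => y < 1
  | 3%N, 4%N => (y < x) || (a < z)
  | 4%N, 1%N => [|| x < z, 1 < z | a < z]
  | 4%N, 2%N => (x < 1) || (z < 1)
  | 4%N, 3%N => z < a
  | _, _ => true
  end.

Lemma Zmx5_gain (R : realType) (x y z a : R) (u v k : 'I_5) :
  0 < x -> 0 < y -> 0 < z -> 0 < a -> y <= a -> y <= x -> y <= z ->
  Zmx 5 x y z a u v * Zmx 5 x y z a v k < Zmx 5 x y z a u k ->
  gain_cond x y z a u v.
Proof.
move=> x0 y0 z0 a0 ya yx yz; rewrite !mxE.
(* When both factors are special entries, their product is a quotient compared with 1, so clearing
   denominators leaves linear inequalities. *)
case: u v k => -[|[|[|[|[|//]]]]] ? [[|[|[|[|[|//]]]]] ?]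
    [[|[|[|[|[|//]]]]] ?] //=;
  rewrite ?mulr1 ?mul1r ?mulVf ?mulfV ?gt_eqF // ?ltxx ?invf_lt1 ?invf_gt1
    ?ltr_pdivrMr ?ltr_pdivrMl ?ltf_pV2 //; lra.
Qed.

Lemma Zmx5_cut (R : realType) (x y z a : R) (V : pred 'I_5) (v u : 'I_5) :
  y <= a -> y <= x -> y <= z ->
  ~ [/\ y < a, a < z, z < x & a < 1] ->
  ~ [/\ y < x, x < z, z < a & 1 < z] ->
  ~ [/\ z < 1, 1 < a & 1 < x] ->
  (forall i j, ~~ V i -> V j -> gain_cond x y z a i j) ->
  (forall i j, ~~ V i -> ~~ V j -> exists e, [/\ ~~ V e, e != i & e != j]) ->
  V v -> V u.
Proof.
move=> ya yx yz Ni Nii Niii gain big.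
pose b (k : nat) := V (inord k).
have g i j : (i < 5)%N -> (j < 5)%N -> b i = false -> b j ->
    gain_cond x y z a i j.
  move=> i5 j5 bi bj; have := gain (inord i) (inord j).
  by rewrite !inordK // -/(b i) bi; apply.
have third i j :
    [|| b i, b j | has (fun k => [&& ~~ b k, k != i & k != j]) (iota 0 5)%N].
  apply/or3P; case bi: (b i); [by constructor|case bj: (b j)];
    first by constructor.
  have [||e [Ve ei ej]] := big (inord i) (inord j);
    rewrite -/(b _) ?bi ?bj //.
  constructor 3; apply/hasP; exists (val e).
    by rewrite mem_iota /= ltn_ord.
  rewrite /b inord_val Ve /=; apply/andP.
  by split; [move: ei|move: ej]; apply: contra_neq => <-; rewrite inord_val.
clear gain big.
(* The complement of [V] is empty or has at least three elements: [third] is applied to all five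
   singletons and ten pairs. *)
have size_b : (b 0 + b 1 + b 2 + b 3 + b 4 \in [:: 0; 1; 2; 5])%N.
  move: (third 0 0) (third 1 1) (third 2 2) (third 3 3) (third 4 4) (third 0 1)
    (third 0 2) (third 0 3) (third 0 4) (third 1 2) (third 1 3) (third 1 4)
    (third 2 3) (third 2 4) (third 3 4) => /=.
  by case: (b 0); case: (b 1); case: (b 2); case: (b 3); case: (b 4).
clear third.
(* Only {1} and {1,2} lead to (i), {4} and {2,4} to (ii), and {2} to (iii); the other ten sets give
   contradictory comparisons. *)
have all_b : all b (iota 0 5) || ~~ has b (iota 0 5).
  rewrite /=; case e0: (b 0) size_b; case e1: (b 1); case e2: (b 2);
    case e3: (b 3); case e4: (b 4) => //= _; exfalso.
  (* [V] is successively {0,1}, {0,2}, {0,3}, {0,4}, {0}, {1,2}, {1,3}, {1,4},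
     {1}, {2,3}, {2,4}, {2}, {3,4}, {3}, {4}. *)
  - by move: (g 3 0 isT isT e3 e0) (g 2 0 isT isT e2 e0) => /=; lra.
  - by move: (g 3 0 isT isT e3 e0) (g 3 2 isT isT e3 e2) => /=; lra.
  - by move: (g 4 3 isT isT e4 e3) (g 1 3 isT isT e1 e3) (g 2 3 isT isT e2 e3)
      => /=; lra.
  - by move: (g 3 0 isT isT e3 e0) (g 2 0 isT isT e2 e0) => /=; lra.
  - by move: (g 3 0 isT isT e3 e0) (g 2 0 isT isT e2 e0) => /=; lra.
  - move: (g 0 2 isT isT e0 e2) (g 4 2 isT isT e4 e2) (g 0 1 isT isT e0 e1)
      (g 4 1 isT isT e4 e1) (g 3 1 isT isT e3 e1) => /= *.
    by apply: Ni; split; lra.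
  - by move: (g 4 3 isT isT e4 e3) (g 0 1 isT isT e0 e1) (g 4 1 isT isT e4 e1)
      (g 2 1 isT isT e2 e1) => /=; lra.
  - by move: (g 0 1 isT isT e0 e1) (g 0 4 isT isT e0 e4) (g 2 4 isT isT e2 e4)
      => /=; lra.
  - move: (g 0 1 isT isT e0 e1) (g 4 1 isT isT e4 e1) (g 3 1 isT isT e3 e1)
      (g 2 1 isT isT e2 e1) => /= *.
    by apply: Ni; split; lra.
  - by move: (g 4 3 isT isT e4 e3) (g 1 3 isT isT e1 e3) (g 1 2 isT isT e1 e2)
      => /=; lra.
  - move: (g 0 2 isT isT e0 e2) (g 3 2 isT isT e3 e2) (g 0 4 isT isT e0 e4)
      (g 1 4 isT isT e1 e4) => /= *.
    by apply: Nii; split; lra.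
  - move: (g 0 2 isT isT e0 e2) (g 1 2 isT isT e1 e2) (g 4 2 isT isT e4 e2)
      => /= *.
    by apply: Niii; split; lra.
  - by move: (g 2 3 isT isT e2 e3) (g 1 3 isT isT e1 e3) (g 1 4 isT isT e1 e4)
      (g 0 4 isT isT e0 e4) => /=; lra.
  - by move: (g 4 3 isT isT e4 e3) (g 1 3 isT isT e1 e3) (g 2 3 isT isT e2 e3)
      => /=; lra.
  - move: (g 0 4 isT isT e0 e4) (g 1 4 isT isT e1 e4) (g 2 4 isT isT e2 e4)
      (g 3 4 isT isT e3 e4) => /= *.
    by apply: Nii; split; lra.
have bE k : V k = b k by rewrite /b inord_val.
have in5 (k : 'I_5) : val k \in iota 0 5 by rewrite mem_iota ltn_ord.
rewrite !bE; case/orP: all_b => [/allP all_b _|/hasPn none bv].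
  by apply: all_b; apply: in5.
by have := none _ (in5 v); rewrite bv.
Qed.

(** * Reduction to size 5 *)

Definition Zclass (n : nat) (i : 'I_n) : 'I_5 :=
  inord (if (i < 2)%N then i : nat else if i == n.-2 :> nat then 3
         else if i == n.-1 :> nat then 4 else 2).

Lemma val_Zclass (n : nat) (i : 'I_n) :
  Zclass i = (if (i < 2)%N then i : nat else if i == n.-2 :> nat then 3
              else if i == n.-1 :> nat then 4 else 2)%N :> nat.
Proof. by rewrite inordK //; do ?case: ifP => //; lia. Qed.

Lemma Zclass_surj (n : nat) (k : 'I_5) :
  (5 <= n)%N -> exists i : 'I_n, Zclass i = k.
Proof.
(* The shift by [n - 5] sends 3 and 4 to [n.-2] and [n.-1]. *)
move=> n5; have lt_n : ((if (k < 3)%N then k : nat else n - 5 + k) < n)%N.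
  by have := ltn_ord k; case: ifP; lia.
exists (Ordinal lt_n); apply/val_inj; rewrite /= val_Zclass /=.
by have := ltn_ord k; do ?case: ifP; lia.
Qed.

Lemma Zmx_class (R : realType) (n : nat) (x y z a : R) (i j : 'I_n) :
  (5 <= n)%N ->
  Zmx n x y z a i j = Zmx 5 x y z a (Zclass i) (Zclass j).
Proof.
move=> n5; rewrite !mxE.
have E0 (k : 'I_n) : (Zclass k == 0 :> nat)%N = (k == 0 :> nat)%N.
  by rewrite val_Zclass; do ?case: ifP; lia.
have E1 (k : 'I_n) : (Zclass k == 1 :> nat)%N = (k == 1 :> nat)%N.
  by rewrite val_Zclass; do ?case: ifP; lia.
have E3 (k : 'I_n) : (Zclass k == 5.-2 :> nat)%N = (k == n.-2 :> nat)%N.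
  by rewrite val_Zclass; do ?case: ifP; lia.
have E4 (k : 'I_n) : (Zclass k == 5.-1 :> nat)%N = (k == n.-1 :> nat)%N.
  by rewrite val_Zclass; do ?case: ifP; lia.
by rewrite !(E0, E1, E3, E4).
Qed.

Lemma Zmx5_reciprocal (R : realType) (x y z a : R) :
  0 < x -> 0 < y -> 0 < z -> 0 < a -> reciprocal (Zmx 5 x y z a).
Proof.
move=> x0 y0 z0 a0 i j; rewrite !mxE.
by case: i j => -[|[|[|[|[|//]]]]] ? [[|[|[|[|[|//]]]]] ?] /=;
  rewrite ?invr_gt0 ?mulVf ?mulfV ?mulr1 ?gt_eqF ?ltr01.
Qed.

Theorem theorem8 (R : realType) (n : nat) (x y z a : R)
    (hn : (5 <= n)%N) (hx : 0 < x) (hy : 0 < y) (hz : 0 < z) (ha : 0 < a)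
    (hmin : y <= Num.min a (Num.min x z))
    (hi : ~ [/\ y < a, a < z, z < x & a < 1])
    (hii : ~ [/\ y < x, x < z, z < a & 1 < z])
    (hiii : ~ [/\ y <= z, z < 1 & 1 < Num.min a x]) :
  forall w : 'cV[R]_n,
    perron_eigenvector (Zmx n x y z a) w -> efficient (Zmx n x y z a) w.
Proof.
move=> w [w0 [lambda _ Zw] _].
have [hya [hyx hyz]] : y <= a /\ y <= x /\ y <= z.
  by move: hmin; rewrite !le_min => /and3P[].
have hiii' : ~ [/\ z < 1, 1 < a & 1 < x].
  by case=> *; apply: hiii; rewrite lt_min; split=> //; apply/andP.
pose Z := Zmx n x y z a; pose Z5 := Zmx 5 x y z a.
have ZE i j : Z i j = Z5 (Zclass i) (Zclass j) by apply: Zmx_class.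
have rZ5 : reciprocal Z5 by apply: Zmx5_reciprocal.
have rZ : reciprocal Z by move=> i j; rewrite !ZE; apply: rZ5.
have l0 : 0 < lambda.
  apply: lt_le_trans (reciprocal_eigenvalue_ge _ rZ w0 Zw); rewrite ?ltr0n;
    lia.
have gain i j : Z i j * w j 0 < w i 0 ->
    gain_cond x y z a (Zclass i) (Zclass j).
  by case/(cut_gain w0 l0 Zw) => k; rewrite -/Z !ZE; apply: Zmx5_gain.
have same_class i j : Zclass i = Zclass j -> w i 0 = w j 0.
  move=> Eij; apply/eqP; rewrite -(inj_eq (mulfI (lt0r_neq0 l0))).
  rewrite -!(eigenvector_row _ Zw) -/Z.
  by apply/eqP/eq_bigr => k _; rewrite !ZE Eij.
apply: efficient_no_cut => // V cutV v Vv u.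
(* Within a class the entry of [Z] is 1 and the weights agree, so a cut separating [i] from [j]
   would give [w i < w i]. *)
have classV i j : Zclass i = Zclass j -> V i -> V j.
  move=> Eij Vi; apply: contraT => Vj; have := cutV _ _ Vj Vi.
  by rewrite -/Z ZE Eij reciprocal_diag // mul1r (same_class _ _ Eij) ltxx.
have /fin_all_exists[rep repE] := fun k => Zclass_surj k hn.
pose w5 : 'cV[R]_5 := \col_k w (rep k) 0.
pose V5 : pred 'I_5 := fun k => V (rep k).
have V5E i : V i = V5 (Zclass i).
  by apply/idP/idP; apply: classV; rewrite repE.
have w5E i : w i 0 = w5 (Zclass i) 0.
  by rewrite mxE; apply: same_class; rewrite repE.
have cutV5 : cut Z5 w5 V5.
  move=> i j Vi Vj; have := cutV _ _ Vi Vj.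
  by rewrite !w5E -/Z ZE !repE.
have Vv5 : V5 (Zclass v) by rewrite -V5E.
(* For [n > 5], [w5] need not be an eigenvector of [Z5], so this property is transferred from [Z]
   and [w]. *)
have source5 i j : Z5 i j * w5 j 0 < w5 i 0 ->
    exists e, w5 i 0 < Z5 i e * w5 e 0.
  rewrite -[i]repE -[j]repE -!w5E -ZE => lt_ij.
  have [e lt_e] := reciprocal_no_source rZ w0 Zw lt_ij.
  by exists (Zclass e); rewrite -w5E -ZE.
have V5_cut := Zmx5_cut (V := V5) (Zclass u) hya hyx hyz hi hii hiii'.
rewrite V5E; apply: (V5_cut _ _ _ Vv5) => i j Vi Vj.
  by have := gain _ _ (cutV _ _ Vi Vj); rewrite !repE.
exact: cut_complement_gt2 rZ5 source5 cutV5 Vv5 Vi Vj.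
Qed.
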